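(* Fix integers $n\ge m>k>0$. (1) Every quantum algorithm that solves the Pattern Matching with Edits problem uses $\Omega(n/m\cdot\sqrt{k(m-k)})$ queries for $P=\mathtt{0}^m$ and some $T\in\{\mathtt{0},\mathtt{1}\}^n$. (2) Every quantum algorithm that decides whether $\mathrm{Occ}^E_k(P,T)\neq\varnothing$ uses $\Omega(\sqrt{n/m}\cdot\sqrt{k(m-k)})$ queries for $P=\mathtt{0}^m$ and some $T\in\{\mathtt{0},\mathtt{1}\}^n$.
   Context: The Pattern Matching with Edits problem: given a pattern $P$ of length $m$, text $T$ of length $n$, and threshold $k$, output $\mathrm{Occ}^E_k(P,T)=\{i\in[0,n] : \exists j\in[i,n],\ \delta_E(P,T[i..j))\le k\}$, where $\delta_E$ is the edit distance (minimum number of insertions, deletions and substitutions). Quantum query model: the text is accessed via an oracle $O_T:|i,b\rangle\mapsto|i,b\oplus T[i]\rangle$, and the query complexity is the number of oracle calls of a bounded-error (success probability at least $2/3$) algorithm correct on all inputs. *)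

(* Defs.v *)
From mathcomp Require Export all_boot all_order all_algebra spectral.
From mathcomp Require Export boolp reals complex.

Set Implicit Arguments.
Unset Strict Implicit.
Unset Printing Implicit Defensive.

Import Order.TTheory GRing.Theory Num.Theory.

Local Open Scope ring_scope.

Variant edit (S : Type) : seq S -> seq S -> Prop :=
| Insertion (u v : seq S) (a : S) : edit (u ++ v) (u ++ a :: v)
| Deletion (u v : seq S) (a : S) : edit (u ++ a :: v) (u ++ v)
| Substitution (u v : seq S) (a b : S) : edit (u ++ a :: v) (u ++ b :: v).

Inductive edits (S : Type) : nat -> seq S -> seq S -> Prop :=
| Edits0 (x : seq S) : edits 0 x x
| EditsS (d : nat) (x y z : seq S) :
    edit x y -> edits d y z -> edits d.+1 x z.

Lemma edits_exist (S : Type) (x y : seq S) : exists d, `[< edits d x y >].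
Proof.
suff: exists d, edits d x y by case=> d Hd; exists d; apply/asboolP.
elim: x => [|a x [d IH]]; last first.
  by exists d.+1; apply: EditsS (Deletion [::] x a) IH.
elim: y => [|b y [d IH]]; first by exists 0%N; constructor.
exists d.+1; elim: IH => [z|e p r q Hpr _ IH].
  by apply: (EditsS (Insertion [::] z b)); constructor.
exact: EditsS Hpr IH.
Qed.

Definition edit_distance (S : Type) (x y : seq S) : nat :=
  ex_minn (edits_exist x y).

(* [drop i (take j T)] is the fragment T[i..j). *)
Definition Occ (S : Type) (m n k : nat) (P : m.-tuple S) (T : n.-tuple S) :
    {set 'I_n.+1} :=
  [set i : 'I_n.+1 | [exists j : 'I_n.+1,
     (i <= j)%N && (edit_distance P (drop i (take j T)) <= k)%N]].

(* Symbols are words of s + 1 bits, so that the bitwise xor of the oracle makes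
   sense; the case s = 0 is the binary alphabet.  Other alphabet sizes are
   obtained by restricting to a subset of the words. *)
Definition symbol (s : nat) : finType := {ffun 'I_s.+1 -> bool}.
Definition symbol_xor (s : nat) (a b : symbol s) : symbol s :=
  [ffun i => a i (+) b i].
Definition symbol0 (s : nat) : symbol s := [ffun => false].
Definition symbol1 (s : nat) : symbol s := [ffun i => i == ord0].

(* The basis states |i, b, w>: i is the query register, b the answer register,
   and w the private workspace. *)
Definition basis (n s : nat) (W : finType) : finType :=
  ('I_n * symbol s * W)%type.

Definition state (R : realType) (n s : nat) (W : finType) : Type :=
  'cV[R[i]]_#|basis n s W|.

Definition ket (R : realType) (n s : nat) (W : finType) (x : basis n s W) :
    state R n s W :=
  delta_mx (enum_rank x) 0.

Definition oracle_basis (n s : nat) (W : finType) (T : n.-tuple (symbol s))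
    (x : basis n s W) : basis n s W :=
  let: (i, b, w) := x in (i, symbol_xor b (tnth T i), w).

Definition oracle (R : realType) (n s : nat) (W : finType)
    (T : n.-tuple (symbol s)) : 'M[R[i]]_#|basis n s W| :=
  \matrix_(y, x) (enum_val y == oracle_basis T (enum_val x))%:R.

Definition project (R : realType) (n s : nat) (W : finType)
    (f : pred (basis n s W)) (psi : state R n s W) : state R n s W :=
  \col_x (if f (enum_val x) then psi x 0 else 0).

Definition normsq (R : realType) (z : R[i]) : R :=
  complex.Re z ^+ 2 + complex.Im z ^+ 2.

(* Query programs with access to a text of length n and output in Out.
   [Halt f] measures all registers in the computational basis and outputs the
   image of the result by f; [Measure f p q] performs the two-outcome projective
   measurement given by f and continues with p if f holds, with q otherwise.
   A program without [Measure] is the usual circuit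
   U_t O_T U_(t-1) ... U_1 O_T U_0 followed by a measurement. *)
Inductive program (R : realType) (n s : nat) (W : finType) (Out : Type) : Type :=
| Halt (f : basis n s W -> Out)
| Gate (U : 'M[R[i]]_#|basis n s W|) (unitaryU : U \is unitarymx)
    (p : program R n s W Out)
| Query (p : program R n s W Out)
| Measure (f : pred (basis n s W)) (p q : program R n s W Out).

(* States are not renormalized after a measurement: the squared norm of psi is
   the probability of reaching the current branch. *)
Fixpoint output_prob (R : realType) (n s : nat) (W : finType) (Out : eqType)
    (T : n.-tuple (symbol s)) (o : Out) (p : program R n s W Out)
    (psi : state R n s W) : R :=
  match p with
  | Halt f => \sum_(x : basis n s W | f x == o) normsq (psi (enum_rank x) 0)
  | Gate U _ p1 => output_prob T o p1 (U *m psi)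
  | Query p1 => output_prob T o p1 (oracle R W T *m psi)
  | Measure f p1 p0 =>
      output_prob T o p1 (project f psi) + output_prob T o p0 (project (predC f) psi)
  end.

(* The maximal number of oracle calls over the branches that are reached with
   positive probability. *)
Fixpoint oracle_calls (R : realType) (n s : nat) (W : finType) (Out : Type)
    (T : n.-tuple (symbol s)) (p : program R n s W Out) (psi : state R n s W) :
    nat :=
  match p with
  | Halt _ => 0
  | Gate U _ p1 => oracle_calls T p1 (U *m psi)
  | Query p1 =>
      if psi == 0 then 0 else (oracle_calls T p1 (oracle R W T *m psi)).+1
  | Measure f p1 p0 =>
      maxn (oracle_calls T p1 (project f psi))
           (oracle_calls T p0 (project (predC f) psi))
  end.

Record query_algorithm (R : realType) (n s : nat) (Out : Type) : Type :=
  QueryAlgorithm {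
    workspace : finType;
    start : basis n s workspace;
    code : program R n s workspace Out
  }.

Definition prob_of_output (R : realType) (n s : nat) (Out : eqType)
    (A : query_algorithm R n s Out) (T : n.-tuple (symbol s)) (o : Out) : R :=
  output_prob T o (code A) (ket R (start A)).

Definition queries (R : realType) (n s : nat) (Out : Type)
    (A : query_algorithm R n s Out) (T : n.-tuple (symbol s)) : nat :=
  oracle_calls T (code A) (ket R (start A)).

(* The pattern is known to the algorithm: only accesses to the text are
   counted.  An algorithm is thus a family of query algorithms indexed by the
   pattern. *)
Definition solves_pattern_matching (R : realType) (n m k s : nat)
    (Sigma : {set symbol s})
    (A : m.-tuple (symbol s) -> query_algorithm R n s {set 'I_n.+1}) : Prop :=
  forall (P : m.-tuple (symbol s)) (T : n.-tuple (symbol s)),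
    {subset P <= Sigma} -> {subset T <= Sigma} ->
    2 / 3 <= prob_of_output (A P) T (Occ k P T).

Definition decides_pattern_matching (R : realType) (n m k s : nat)
    (Sigma : {set symbol s})
    (A : m.-tuple (symbol s) -> query_algorithm R n s bool) : Prop :=
  forall (P : m.-tuple (symbol s)) (T : n.-tuple (symbol s)),
    {subset P <= Sigma} -> {subset T <= Sigma} ->
    2 / 3 <= prob_of_output (A P) T (Occ k P T != set0).

(* Main.v *)
(* Quantum adversary argument.  The hard texts consist of b ~ n / (2m) blocks
   of length m, separated by m ones, such that each block contains k or k + 1
   ones.  An edge joins a text x with exactly h blocks of k ones to the text y
   obtained by turning a one of a block of k + 1 ones into a zero: this changes
   the answer, since the start of the block becomes an occurrence, and there was
   none before if h = 0.  Every x has (b - h) (k + 1) neighbours, every y has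
   (h + 1) (m - k), and the two ends of an edge differ in one position only.
   Summed over the edges, the inner products of the states of the two ends start
   at the number of edges, have to drop by a constant factor before the final
   measurement, and drop by at most a fraction
   2 / sqrt ((b - h) (k + 1) (h + 1) (m - k)) of it in each query.  The theorem
   follows with h = b / 2 and with h = 0. *)

Require Import Defs.
From mathcomp Require Import ring lra zify.
Import Order.TTheory GRing.Theory Num.Theory.

Set Implicit Arguments.
Unset Strict Implicit.
Unset Printing Implicit Defensive.

Local Open Scope ring_scope.

(** * Real inner products of states and the action of gates, oracles and measurements on them *)

Section Amplitudes.
Local Open Scope sesquilinear_scope.
Variables (R : realType) (n s : nat) (W : finType).
Local Notation state := (state R n s W).
Local Notation basis := (basis n s W).
Implicit Types (psi phi : state) (f : pred basis) (T : n.-tuple (symbol s)).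

(** The real part of the product of [v] with the conjugate of [u]. Taking real parts keeps every
    quantity of the argument in the ordered field [R]. *)
Definition rdot (u v : R[i]) : R :=
  complex.Re u * complex.Re v + complex.Im u * complex.Im v.

Lemma rdot_le (a b : R) (u v : R[i]) : 0 < a -> 1 <= 4 * (a * b) ->
  rdot u v <= a * normsq u + b * normsq v.
Proof.
move=> a0 ab; case: u v => [u1 u2] [v1 v2]; rewrite /rdot /normsq /=.
have sq0 (x y : R) : x * y <= a * x ^+ 2 + b * y ^+ 2.
  have a4 : 0 < 4 * a by rewrite mulr_gt0.
  rewrite -(ler_pM2l a4) -subr_ge0.
  (* Completing the square: [1 <= 4 * (a * b)] says that the quadratic form has nonpositive
     discriminant. *)
  have -> : 4 * a * (a * x ^+ 2 + b * y ^+ 2) - 4 * a * (x * y) =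
    (2 * a * x - y) ^+ 2 + (4 * (a * b) - 1) * y ^+ 2 by ring.
  by rewrite addr_ge0 ?sqr_ge0 // mulr_ge0 ?sqr_ge0 ?subr_ge0.
by have := sq0 u1 v1; have := sq0 u2 v2; lra.
Qed.

Lemma normsq_ge0 (u : R[i]) : 0 <= normsq u.
Proof. by rewrite addr_ge0 ?sqr_ge0. Qed.

Definition amp psi (z : basis) : R[i] := psi (enum_rank z) 0.
(** Restricting the sum to [f] serves twice: for the outcome of a measurement, and for the part of a
    state in which a given position is queried. *)
Definition dot f psi phi : R := \sum_(z | f z) rdot (amp psi z) (amp phi z).
Definition weight f psi : R := \sum_(z | f z) normsq (amp psi z).

Lemma weight_ge0 f psi : 0 <= weight f psi.
Proof. by apply: sumr_ge0 => z _; apply: normsq_ge0. Qed.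

Lemma dot_weight f psi : dot f psi psi = weight f psi.
Proof. by apply: eq_bigr => z _; rewrite /rdot /normsq !expr2. Qed.

Lemma dot_le f psi phi (a b : R) : 0 < a -> 1 <= 4 * (a * b) ->
  dot f psi phi <= a * weight f psi + b * weight f phi.
Proof.
move=> a0 ab; rewrite !mulr_sumr -big_split /=; apply: ler_sum => z _.
exact: rdot_le.
Qed.

Lemma dot_predT psi phi : dot predT psi phi = complex.Re ((psi^t* *m phi) 0 0).
Proof.
rewrite /dot !mxE (reindex (@enum_val _ (mem basis))) /=; last first.
  by exists enum_rank => x _; [exact: enum_valK | exact: enum_rankK].
rewrite (raddf_sum (@complex.Re R)) /=; apply: eq_bigr => z _.
rewrite /amp enum_valK !mxE.
by case: (psi z 0) (phi z 0) => [a b] [c d] /=; rewrite /rdot /=; ring.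
Qed.

Lemma dot_unitary (U : 'M[R[i]]_#|basis|) psi phi : U \is unitarymx ->
  dot predT (U *m psi) (U *m phi) = dot predT psi phi.
Proof.
(* Unitarity is given with the adjoint on the right of [U], but is used with the adjoint on the
   left. *)
move=> /unitarymxP /mulmx1C UU.
by rewrite !dot_predT trmx_mul map_mxM mulmxA -(mulmxA _ _ U) UU mulmx1.
Qed.

Lemma oracle_basisK T : involutive (@oracle_basis n s W T).
Proof.
move=> [[i b] w] /=; congr (_, _, _); apply/ffunP => j.
by rewrite !ffunE addbK.
Qed.

Lemma amp_oracle T psi z :
  amp (oracle R W T *m psi) z = amp psi (oracle_basis T z).
Proof.
rewrite /amp mxE (bigD1 (enum_rank (oracle_basis T z))) //=.
rewrite mxE !enum_rankK oracle_basisK eqxx mul1r big1 ?addr0 // => x xz.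
rewrite mxE enum_rankK; case: eqP => [zE|]; last by rewrite mul0r.
by move: xz; rewrite zE oracle_basisK enum_valK eqxx.
Qed.

Lemma amp_project f psi z : amp (project f psi) z = if f z then amp psi z else 0.
Proof. by rewrite /amp mxE enum_rankK. Qed.

Lemma dot_project f psi phi :
  dot predT (project f psi) (project f phi) = dot f psi phi.
Proof.
rewrite /dot [RHS]big_mkcond; apply: eq_bigr => z _ /=.
by rewrite !amp_project; case: ifP => _ //; rewrite /rdot /= mulr0 addr0.
Qed.

Lemma dot_split f psi phi :
  dot predT psi phi = dot f psi phi + dot (predC f) psi phi.
Proof. by rewrite /dot (bigID f). Qed.

Lemma dot_predT_query psi phi :
  dot predT psi phi = \sum_(i < n) dot (fun z => z.1.1 == i) psi phi.
Proof.
rewrite /dot (partition_big (fun z : basis => z.1.1) predT) //=.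
Qed.

Lemma weight_oracle T psi i :
  weight (fun z => z.1.1 == i) (oracle R W T *m psi) =
  weight (fun z => z.1.1 == i) psi.
Proof.
rewrite /weight [RHS](reindex_inj (inv_inj (oracle_basisK T))) /=.
by apply: eq_big => [[[j b] w]|z _] //; rewrite amp_oracle.
Qed.

(** On the part that queries [i], the two oracles act as the same permutation of the basis. *)
Lemma dot_oracle T T' psi phi i : tnth T i = tnth T' i ->
  dot (fun z => z.1.1 == i) (oracle R W T *m psi) (oracle R W T' *m phi) =
  dot (fun z => z.1.1 == i) psi phi.
Proof.
move=> TT'; rewrite /dot [RHS](reindex_inj (inv_inj (oracle_basisK T))) /=.
apply: eq_big => [[[j b] w]|[[j b] w] /eqP /= ->] //.
by rewrite !amp_oracle /= TT'.
Qed.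

Lemma amp_ket (x z : basis) : amp (ket R x) z = (z == x)%:R.
Proof. by rewrite /amp mxE eqxx andbT (inj_eq enum_rank_inj). Qed.

Lemma dot_ket (x : basis) : dot predT (ket R x) (ket R x) = 1.
Proof.
rewrite /dot (bigD1 x) //= big1 => [|z /negPf zx].
  by rewrite amp_ket eqxx /rdot /= mulr1 mulr0 !addr0.
by rewrite amp_ket zx /rdot /= mulr0 addr0.
Qed.

End Amplitudes.

(** * The adversary method on a bipartite graph of inputs *)

Lemma ler_sum_inj (R : numDomainType) (I J : finType) (E : {set I})
    (B : {set J}) (h : I -> J) (F : J -> R) :
  (forall j, 0 <= F j) -> {in E &, injective h} ->
  (forall e, e \in E -> h e \in B) ->
  \sum_(e in E) F (h e) <= \sum_(j in B) F j.
Proof.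
move=> F0 injh hB; rewrite -(big_imset _ injh) /=.
rewrite [leRHS](big_setID (h @: E)) /=.
have /setIidPr -> : h @: E \subset B by apply/subsetP => _ /imsetP[e /hB eB ->].
by rewrite lerDl sumr_ge0.
Qed.

Section Adversary.
Variables (R : realType) (n s : nat) (Out : eqType) (V I : finType).
Variables (text : V -> n.-tuple (symbol s)) (answer : V -> Out).
Variables (X Y : {set V}) (E : {set I}).
Variables (src dst : I -> V) (pos : I -> 'I_n).
Hypothesis srcX : forall e, e \in E -> src e \in X.
Hypothesis dstY : forall e, e \in E -> dst e \in Y.
Hypothesis src_inj : {in E &, injective (fun e => (src e, pos e))}.
Hypothesis dst_inj : {in E &, injective (fun e => (dst e, pos e))}.
Hypothesis text_agree : forall e, e \in E -> forall i, i != pos e ->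
  tnth (text (src e)) i = tnth (text (dst e)) i.
Hypothesis answer_neq : forall e, e \in E -> answer (src e) != answer (dst e).

(** The edges at one vertex have distinct positions, so their query weights are disjoint parts of
    the squared norm of the state of that vertex. *)
Lemma sum_query_weight (W : finType) (psi : V -> state R n s W) (g : I -> V)
    (B : {set V}) :
  (forall e, e \in E -> g e \in B) -> {in E &, injective (fun e => (g e, pos e))} ->
  \sum_(e in E) weight (fun z => z.1.1 == pos e) (psi (g e)) <=
  \sum_(v in B) dot predT (psi v) (psi v).
Proof.
move=> gB ginj; pose F u := weight (fun z => z.1.1 == u.2) (psi u.1).
have F0 u : 0 <= F u by apply: weight_ge0.
have hB e : e \in E -> (g e, pos e) \in setX B setT.
  by move=> eE; rewrite in_setX gB // inE.
apply: le_trans (ler_sum_inj F0 ginj hB) _.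
rewrite (eq_bigl (fun u : V * 'I_n => (u.1 \in B) && true)) => [|u]; last first.
  by rewrite inE in_setT.
rewrite -(pair_big (mem B) predT (fun v i => F (v, i))) /=.
apply: ler_sum => v _; rewrite dot_predT_query; apply: ler_sum => i _.
by rewrite dot_weight.
Qed.

(** Only the parts querying [i0] can change their inner product. Its values before and after the
    query are each bounded by AM-GM with weights [a / 2] and [a^-1 / 2], and the oracles preserve
    the query weights. *)
Lemma query_progress (W : finType) (psi phi : state R n s W) (a : R)
    (T T' : n.-tuple (symbol s)) (i0 : 'I_n) : 0 < a ->
  (forall i, i != i0 -> tnth T i = tnth T' i) ->
  dot predT psi phi - dot predT (oracle R W T *m psi) (oracle R W T' *m phi) <=
  a * weight (fun z => z.1.1 == i0) psi + a^-1 * weight (fun z => z.1.1 == i0) phi.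
Proof.
move=> a0 TT'; rewrite !dot_predT_query (bigD1 i0) //= [X in _ - X](bigD1 i0) //=.
under [X in _ - (_ + X)]eq_bigr => i ii0 do rewrite dot_oracle ?TT' //.
rewrite opprD addrACA subrr addr0.
have a2 : 0 < a / 2 by rewrite divr_gt0.
have a2V : 1 <= 4 * (a / 2 * (a^-1 / 2)).
  have -> // : 4 * (a / 2 * (a^-1 / 2)) = 1 :> R.
  by field; rewrite gt_eqF.
set f := fun z : basis n s W => z.1.1 == i0.
have H1 := dot_le f psi phi a2 a2V.
have H2 : - dot f (oracle R W T *m psi) (oracle R W T' *m phi) <=
   a / 2 * weight f psi + a^-1 / 2 * weight f phi.
  rewrite -(weight_oracle T psi) -(weight_oracle T' phi).
  set u := oracle _ _ _ *m _; set v := oracle _ _ _ *m _.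
  rewrite /dot !mulr_sumr -sumrN -big_split; apply: ler_sum => z _ /=.
  have := rdot_le (- amp u z) (amp v z) a2 a2V.
  case: (amp u z) (amp v z) => [u1 u2] [v1 v2].
  by rewrite /rdot /normsq /= !sqrrN !mulNr -opprD.
by lra.
Qed.

(* AM-GM with weights 3/8 and 2/3, the smaller weight being given to the state
   for which the measured outcome is the right one; 7/24 = 2/3 - 3/8. *)
Lemma halt_progress (W : finType) (f : basis n s W -> Out)
    (psi phi : state R n s W) (o o' : Out) : o != o' ->
  dot predT psi phi <=
  2 / 3 * (dot predT psi psi + dot predT phi phi) -
  7 / 24 * ((\sum_(z | f z == o) normsq (psi (enum_rank z) 0)) +
            (\sum_(z | f z == o') normsq (phi (enum_rank z) 0))).
Proof.
move=> oo'; rewrite !dot_weight.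
rewrite [X in 7 / 24 * (X + _)]big_mkcond [X in 7 / 24 * (_ + X)]big_mkcond /=.
rewrite /dot /weight -!big_split /= !mulr_sumr -sumrB; apply: ler_sum => z _.
rewrite -/(amp psi z) -/(amp phi z).
have [p0 q0] := (normsq_ge0 (amp psi z), normsq_ge0 (amp phi z)).
have [fo|fo] := eqVneq (f z) o.
  rewrite -fo in oo'; rewrite (negPf oo').
  by have := @rdot_le _ (3 / 8) (2 / 3) (amp psi z) (amp phi z); lra.
case: eqP => _.
  by have := @rdot_le _ (2 / 3) (3 / 8) (amp psi z) (amp phi z); lra.
by have := @rdot_le _ (2 / 3) (2 / 3) (amp psi z) (amp phi z); lra.
Qed.

(** The left side sums how far the inner products exceed the bound of [halt_progress]. This excess
    is at most 0 when the program halts, is kept by gates, drops in a query by at most what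
    [query_progress] allows, and is additive over the branches of a measurement. The states are
    arbitrary and unnormalized so that the induction passes through every instruction; [a] stays
    free to balance the degrees of the two sides. *)
Lemma program_progress (W : finType) (p : program R n s W Out)
    (psi : V -> state R n s W) (a : R) : 0 < a ->
  \sum_(e in E) (dot predT (psi (src e)) (psi (dst e)) -
    (2 / 3 * (dot predT (psi (src e)) (psi (src e)) +
              dot predT (psi (dst e)) (psi (dst e))) -
     7 / 24 * (output_prob (text (src e)) (answer (src e)) p (psi (src e)) +
               output_prob (text (dst e)) (answer (dst e)) p (psi (dst e))))) <=
  a * (\sum_(v in X) (oracle_calls (text v) p (psi v))%:R *
                       dot predT (psi v) (psi v)) +
  a^-1 * (\sum_(v in Y) (oracle_calls (text v) p (psi v))%:R *
                       dot predT (psi v) (psi v)).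
Proof.
move=> a0; elim: p psi => [f|U unitU p IH|p IH|f p IHp q IHq] psi /=.
- rewrite [X in a * X]big1 => [|v _]; last by rewrite mulr0n mul0r.
  rewrite [X in a^-1 * X]big1 => [|v _]; last by rewrite mulr0n mul0r.
  rewrite !mulr0 addr0.
  apply: sumr_le0 => e eE; rewrite subr_le0; exact: halt_progress (answer_neq eE).
- have /= := IH (fun v => U *m psi v).
  under eq_bigr => e _ do rewrite !dot_unitary //.
  under [\sum_(v in X) _]eq_bigr => v _ do rewrite dot_unitary //.
  by under [\sum_(v in Y) _]eq_bigr => v _ do rewrite dot_unitary //.
- pose phi v := oracle R W (text v) *m psi v.
  have phiE v : dot predT (phi v) (phi v) = dot predT (psi v) (psi v).
    by rewrite !dot_predT_query; apply: eq_bigr => i _; rewrite dot_oracle.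
  (* A query on the zero state is not counted, but there the squared norm vanishes and the identity
     still holds. *)
  have callsE v :
    (if psi v == 0 then 0%N else (oracle_calls (text v) p (phi v)).+1)%:R *
      dot predT (psi v) (psi v) =
    (oracle_calls (text v) p (phi v))%:R * dot predT (phi v) (phi v) +
    dot predT (psi v) (psi v).
    rewrite phiE; case: eqP => [->|_]; last by rewrite -natr1 mulrDl mul1r.
    have -> : dot predT (0 : state R n s W) 0 = 0.
      by apply: big1 => z _; rewrite /amp mxE /rdot /= mulr0 addr0.
    by rewrite !mulr0 addr0.
  under [\sum_(v in X) _]eq_bigr => v _ do rewrite callsE.
  under [\sum_(v in Y) _]eq_bigr => v _ do rewrite callsE.
  rewrite !big_split /= !mulrDr addrACA.
  have wX := sum_query_weight psi srcX src_inj.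
  have wY := sum_query_weight psi dstY dst_inj.
  apply: le_trans (lerD (IH phi) (lerD (ler_wpM2l (ltW a0) wX)
    (ler_wpM2l _ wY))); last by rewrite invr_ge0 ltW.
  rewrite !mulr_sumr -!big_split; apply: ler_sum => e eE /=; rewrite !phiE.
  have := query_progress (psi (src e)) (psi (dst e)) a0 (text_agree eE).
  rewrite -!/(phi _); lra.
- have split v w : dot predT (psi v) (psi w) =
    dot predT (project f (psi v)) (project f (psi w)) +
    dot predT (project (predC f) (psi v)) (project (predC f) (psi w)).
    by rewrite !dot_project -dot_split.
  have := lerD (IHp (fun v => project f (psi v)))
               (IHq (fun v => project (predC f) (psi v))).
  rewrite -big_split /= => H.
  apply: le_trans (le_trans H _).
    by apply: ler_sum => e _; rewrite !split; lra.
  (* The squared norms of the two branches add up to that of [psi v], so a mean of the two query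
     counts is bounded by their maximum. *)
  have calls (B : {set V}) :
    \sum_(v in B) (oracle_calls (text v) p (project f (psi v)))%:R *
       dot predT (project f (psi v)) (project f (psi v)) +
    \sum_(v in B) (oracle_calls (text v) q (project (predC f) (psi v)))%:R *
       dot predT (project (predC f) (psi v)) (project (predC f) (psi v)) <=
    \sum_(v in B) (maxn (oracle_calls (text v) p (project f (psi v)))
      (oracle_calls (text v) q (project (predC f) (psi v))))%:R *
       dot predT (psi v) (psi v).
    rewrite -big_split /=; apply: ler_sum => v _; rewrite split mulrDr.
    by rewrite lerD // ler_wpM2r ?ler_nat ?leq_maxl ?leq_maxr // dot_weight
               weight_ge0.
  rewrite addrACA -!mulrDr.
  by rewrite lerD // ler_wpM2l ?calls // ?invr_ge0 ltW.
Qed.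

(** The two cardinality equations make [dX] and [dY] the average degrees on the two sides. If all
    query counts were below the bound, the right side of [program_progress] would be less than
    [#|E| / 18], while success on both ends of each edge makes the left side at least that. *)
Theorem adversary_bound (A : query_algorithm R n s Out) (dX dY : nat) :
  (0 < #|E|)%N -> #|E| = (#|X| * dX)%N -> #|E| = (#|Y| * dY)%N ->
  (forall v, v \in X :|: Y -> 2 / 3 <= prob_of_output A (text v) (answer v)) ->
  exists2 v, v \in X :|: Y &
    36^-1 * Num.sqrt (dX * dY)%:R <= (queries A (text v))%:R :> R.
Proof.
move=> E0 EX EY correct; apply: contrapT => small.
set B := 36^-1 * _ in small.
have {}small v : v \in X :|: Y -> (queries A (text v))%:R < B.
  by move=> vXY; rewrite ltNge; apply/negP => Bv; apply: small; exists v.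
have dX0 : (0 < dX)%N by move: E0; rewrite EX muln_gt0 => /andP[].
have dY0 : (0 < dY)%N by move: E0; rewrite EY muln_gt0 => /andP[].
have X0 : (0 < #|X|)%N by move: E0; rewrite EX muln_gt0 => /andP[].
pose x := Num.sqrt dX%:R : R; pose y := Num.sqrt dY%:R : R.
have x0 : 0 < x by rewrite sqrtr_gt0 ltr0n.
have y0 : 0 < y by rewrite sqrtr_gt0 ltr0n.
have xx : x * x = dX%:R by rewrite -expr2 sqr_sqrtr // ler0n.
have yy : y * y = dY%:R by rewrite -expr2 sqr_sqrtr // ler0n.
(* The choice [a = x / y], the root of [dX / dY], makes both sides contribute equally: each gives
   [#|E| * B / (x * y)], that is [#|E| / 36]. *)
have a0 : 0 < x / y by rewrite divr_gt0.
have := program_progress (code A) (fun=> ket R (start A)) a0.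
rewrite !dot_ket; apply/negP; rewrite -ltNge.
have sumY :
  \sum_(v in Y) (oracle_calls (text v) (code A) (ket R (start A)))%:R * 1 <=
  #|Y|%:R * B.
  rewrite -sumr_const mulr_suml; apply: ler_sum => v vY.
  by rewrite mulr1 mul1r ltW ?small // inE vY orbT.
have sumX :
  \sum_(v in X) (oracle_calls (text v) (code A) (ket R (start A)))%:R * 1 <
  #|X|%:R * B.
  rewrite -sumr_const mulr_suml; apply: ltr_sum => [|v vX].
    move: X0; rewrite card_gt0 => /set0Pn[v vX].
    by apply/hasP; exists v; rewrite ?mem_index_enum.
  by rewrite mulr1 mul1r small // inE vX.
have yx0 : 0 <= (x / y)^-1 by rewrite invr_ge0 ltW.
rewrite -(ltr_pM2l a0) in sumX.
apply: (lt_le_trans (ltr_leD sumX (ler_wpM2l yx0 sumY))).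
have BE : B = 36^-1 * (x * y) by rewrite /B natrM sqrtrM ?ler0n.
have EXr : #|E|%:R = #|X|%:R * (x * x) :> R by rewrite EX natrM xx.
have EYr : #|E|%:R = #|Y|%:R * (y * y) :> R by rewrite EY natrM yy.
have -> : x / y * (#|X|%:R * B) + (x / y)^-1 * (#|Y|%:R * B) = 18^-1 * #|E|%:R.
  have -> : 18^-1 * #|E|%:R =
    36^-1 * (#|X|%:R * (x * x)) + 36^-1 * (#|Y|%:R * (y * y)) :> R.
    by rewrite -EXr -EYr; field.
  by rewrite BE; field; rewrite !gt_eqF.
(* Each edge contributes at least 1 - (4/3 - 7/24 * 4/3) = 1/18, since the inner product starts at 1
   and both success probabilities are at least 2/3. *)
rewrite -sumr_const mulr_sumr; apply: ler_sum => e eE.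
have := correct (src e); have := correct (dst e).
rewrite !inE srcX // dstY // orbT /= /prob_of_output => /(_ isT) H1 /(_ isT) H2.
by lra.
Qed.

End Adversary.

(** * Edit distance, symbol counts and occurrences of a unary pattern *)

Section EditDistance.
Local Open Scope nat_scope.

(** A single edit changes the number of symbols satisfying [a] by at most one. *)
Lemma edits_count (S : Type) (a : pred S) (d : nat) (x y : seq S) :
  edits d x y -> count a x <= count a y + d /\ count a y <= count a x + d.
Proof.
elim=> [z|{}d {}x z {}y xz _ [IH1 IH2]]; first by rewrite addn0.
have [H1 H2] : count a x <= count a z + 1 /\ count a z <= count a x + 1.
  by case: xz => [u v c|u v c|u v c c']; rewrite !count_cat /=;
    case: (a c) => //=; try case: (a c') => //=; lia.
by split; lia.
Qed.

Lemma edits_cons (S : Type) (d : nat) (b : S) (x y : seq S) :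
  edits d x y -> edits d (b :: x) (b :: y).
Proof.
elim=> [z|{}d {}x z {}y xz _ IH]; first exact: Edits0.
apply: EditsS IH; case: xz => [u v c|u v c|u v c c'].
- exact: (Insertion (b :: u)).
- exact: (Deletion (b :: u)).
- exact: (Substitution (b :: u)).
Qed.

Lemma edits_edit_distance (S : Type) (x y : seq S) :
  edits (edit_distance x y) x y.
Proof. by rewrite /edit_distance; case: ex_minnP => d /asboolP. Qed.

Lemma edit_distance_le (S : Type) (d : nat) (x y : seq S) :
  edits d x y -> edit_distance x y <= d.
Proof.
by move=> xy; rewrite /edit_distance; case: ex_minnP => e _; apply; apply/asboolP.
Qed.

(** Substitutions alone suffice: this is the Hamming distance. *)
Lemma edit_distance_nseq (S : eqType) (a : S) (y : seq S) :
  edit_distance (nseq (size y) a) y <= count (predC1 a) y.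
Proof.
apply: edit_distance_le; elim: y => [|b y IH] /=; first exact: Edits0.
have [->|ba] := eqVneq b a; first by rewrite add0n; apply: edits_cons.
rewrite add1n; apply: EditsS (Substitution [::] _ a b) _.
exact: edits_cons.
Qed.

(** Turns comparisons of counts in different fragments into inclusions of sets of positions. *)
Lemma count_fragment (S : Type) (n i j : nat) (a : pred S) (T : n.-tuple S) :
  count a (drop i (take j T)) =
  #|[set p : 'I_n | (i <= p < j) && a (tnth T p)]|.
Proof.
(* A nonempty text supplies the default symbol for [nth]. *)
case: n T => [|n] T.
  rewrite tuple0 /=; apply/esym/eqP; rewrite cards_eq0; apply/eqP/setP.
  by case.
have x0 := tnth T ord0.
have -> : drop i (take j T) =
    [seq nth x0 T p | p <- iota i (minn j n.+1 - i)].
  rewrite map_nth_iota ?size_tuple ?leq_sub2r ?geq_minr //.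
  have [ij|ji] := leqP (minn j n.+1) i.
    have /eqP-> : minn j n.+1 - i == 0 by rewrite subn_eq0.
    by rewrite take0 drop_oversize // size_take_min size_tuple.
  rewrite take_drop subnK ?(ltnW ji) // /minn; case: ltnP => // nj.
  by rewrite !take_oversize ?size_tuple.
rewrite count_map -sum1_count -sum1dep_card.
rewrite -[iota _ _]/(index_iota i _) big_geq_mkord /=.
rewrite (big_ord_widen_cond n.+1 (fun p => a (nth x0 T p) && (i <= p))
  (fun=> 1)) ?geq_minr //.
apply: eq_bigl => p; rewrite (tnth_nth x0) leq_min ltn_ord andbT.
by rewrite andbC andbA [in RHS]andbC; case: (a _); rewrite ?andbT ?andbF //= andbC.
Qed.

End EditDistance.

(** A fragment ending within the window of length [m] has too few symbols [a]. A longer one contains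
    the window, hence more than [k] symbols other than [a], none of which is in the pattern. *)
Lemma notin_Occ (S : eqType) (m n k : nat) (a : S) (T : n.-tuple S) (i : 'I_n.+1) :
  (count (pred1 a) (drop i (take (i + m) T)) < m - k)%N ->
  i \notin Occ k (nseq_tuple m a) T.
Proof.
move=> few; rewrite inE; apply/existsPn => j; apply/negP => /andP[ij].
apply/negP; rewrite -ltnNge.
set d := edit_distance _ _.
have ed := edits_edit_distance (nseq_tuple m a) (drop i (take j T)).
have [zeros _] := edits_count (pred1 a) ed.
have [_ ones] := edits_count (predC1 a) ed.
rewrite -/d /= !count_nseq /= eqxx mul1n mul0n add0n in zeros ones.
have [jm|mj] := leqP j (i + m).
  have : (count (pred1 a) (drop i (take j T)) <=
          count (pred1 a) (drop i (take (i + m) T)))%N.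
    rewrite !count_fragment; apply/subset_leq_card/subsetP => p.
    rewrite !inE => /andP[/andP[-> pj] ->]; rewrite andbT /=.
    exact: leq_trans jm.
  by lia.
have : (count (predC1 a) (drop i (take (i + m) T)) <=
        count (predC1 a) (drop i (take j T)))%N.
  rewrite !count_fragment; apply/subset_leq_card/subsetP => p.
  rewrite !inE => /andP[/andP[-> pj] ->]; rewrite andbT /=.
  exact: ltn_trans mj.
have := count_predC (pred1 a) (drop i (take (i + m) T)).
(* In this case the window is not cut off by the end of the text, so it has exactly [m] symbols. *)
have imn : (i + m <= n)%N by move: (ltn_ord j); lia.
rewrite size_drop size_takel ?size_tuple // addKn.
have -> : count (predC (pred1 a)) (drop i (take (i + m) T)) =
  count (predC1 a) (drop i (take (i + m) T)) by apply: eq_count.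
by lia.
Qed.

Lemma mem_Occ (S : eqType) (m n k : nat) (a : S) (T : n.-tuple S) (i : 'I_n.+1) :
  (i + m <= n)%N ->
  (count (predC1 a) (drop i (take (i + m) T)) <= k)%N ->
  i \in Occ k (nseq_tuple m a) T.
Proof.
move=> imn few; rewrite inE; apply/existsP.
exists (inord (i + m)); rewrite inordK ?ltnS // leq_addr /=.
have szw : size (drop i (take (i + m) T)) = m.
  by rewrite size_drop size_takel ?size_tuple // addKn.
by have := edit_distance_nseq a (drop i (take (i + m) T)); rewrite szw; lia.
Qed.

Lemma card_ord_lt (m r : nat) : (r <= m)%N -> #|[set j : 'I_m | (j < r)%N]| = r.
Proof.
by move=> rm; rewrite -sum1dep_card -(big_ord_widen m (fun=> 1%N) rm) sum1_card card_ord.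
Qed.

Lemma card_fibres (A B : finType) (P : {set A}) (Q : A -> pred B) (d : nat) :
  (forall x, x \in P -> #|[set y | Q x y]| = d) ->
  #|[set e : A * B | (e.1 \in P) && Q e.1 e.2]| = (#|P| * d)%N.
Proof.
move=> Pd; rewrite -sum1dep_card -(pair_big_dep (mem P) Q (fun _ _ => 1%N)) /=.
rewrite -sum_nat_const; apply: eq_bigr => x /Pd <-; exact: sum1dep_card.
Qed.

(** * The hard texts and the graph on them *)

Section Inputs.
Variables (n m k b s : nat).
Hypothesis km : (k < m)%N.
(** Block [t] starts at [2 * m * t]; the term [m] on the right is there because no gap has to follow
    the last block. *)
Hypothesis blocks_fit : (2 * m * b <= n + m)%N.
Local Notation cell := ('I_b * 'I_m)%type.
Implicit Types (x y : {set cell}) (c : cell) (t : 'I_b).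

Fact position_subproof c : (2 * m * c.1 + c.2 < n)%N.
Proof using blocks_fit. by case: c => [[t tb] [j jm]] /=; clear km; nia. Qed.

(* The gap between two blocks is as long as the pattern, so that no window
   meets two blocks. *)
Definition position c : 'I_n := Ordinal (position_subproof c).

Lemma position_near c c' : (position c < position c' + m)%N ->
  (position c' < position c + m)%N -> c.1 = c'.1.
Proof.
case: c c' => [t [j jm]] [t' [j' jm']] /= H1 H2; apply/val_inj => /=.
by nia.
Qed.

Lemma position_inj : injective position.
Proof.
move=> c c' cc'; have m0 : (0 < m)%N by lia.
have tt' : c.1 = c'.1 by apply: position_near; rewrite cc'; lia.
case: c c' cc' tt' => [t j] [t' j'] /(congr1 val) /= H tt'; subst t'.
by congr (_, _); apply/val_inj/(addnI H).
Qed.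

(** [x] is the set of cells that hold a one; every position outside the blocks holds a one as
    well. *)
Definition block_text x : n.-tuple (symbol s) :=
  [tuple if [exists c, (c \notin x) && (position c == p)]
         then symbol0 s else symbol1 s | p < n].

Lemma symbol1_neq0 : symbol1 s != symbol0 s.
Proof. by apply/eqP => /ffunP /(_ ord0); rewrite !ffunE eqxx. Qed.

Lemma block_text_binary x : {subset block_text x <= [:: symbol0 s; symbol1 s]}.
Proof.
move=> a /tnthP[p ->]; rewrite tnth_mktuple !inE.
by case: ifP; rewrite eqxx ?orbT.
Qed.

Lemma block_text0 x (p : 'I_n) :
  reflect (exists2 c, c \notin x & position c = p)
          (tnth (block_text x) p == symbol0 s).
Proof.
rewrite tnth_mktuple; apply: (iffP eqP).
  case: ifPn => [/existsP[c /andP[cx /eqP cp]] _|_ /eqP]; first by exists c.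
  by rewrite (negPf symbol1_neq0).
by move=> [c cx cp]; rewrite ifT //; apply/existsP; exists c; rewrite cx cp eqxx.
Qed.

Lemma block_text_setD1 x c p : p != position c ->
  tnth (block_text x) p = tnth (block_text (x :\ c)) p.
Proof.
move=> pc; rewrite !tnth_mktuple; congr (if _ then _ else _).
apply: eq_existsb => c'; rewrite !inE negb_and negbK.
have [->|] //= := eqVneq c' c.
by rewrite [position c == p]eq_sym (negPf pc) andbF.
Qed.

Definition ones x t : nat := #|[set j | (t, j) \in x]|.

Lemma card_zeros x t : #|[set j | (t, j) \notin x]| = (m - ones x t)%N.
Proof.
rewrite cardsCs card_ord; congr (_ - _)%N; apply: eq_card => j.
by rewrite !inE negbK.
Qed.

(** By [position_near], all zeros of a window that meets a block lie in that block. *)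
Lemma count_zeros_window x i c : (i <= position c < i + m)%N ->
  (count (pred1 (symbol0 s)) (drop i (take (i + m) (block_text x))) <=
   m - ones x c.1)%N.
Proof.
move=> /andP[ic ci]; rewrite count_fragment -card_zeros.
apply: leq_trans (leq_imset_card (fun j => position (c.1, j)) _).
apply/subset_leq_card/subsetP => p.
rewrite inE => /andP[/andP[ip pi] /block_text0[c' c'x c'p]].
have c1 : c'.1 = c.1 by apply: position_near; rewrite c'p; lia.
apply/imsetP; exists c'.2; first by rewrite inE -c1 -surjective_pairing.
by rewrite -c1 -surjective_pairing.
Qed.

Lemma block_start_subproof t : (2 * m * t < n.+1)%N.
Proof using blocks_fit. by case: t => [t tb] /=; clear km; nia. Qed.
Definition block_start t : 'I_n.+1 := Ordinal (block_start_subproof t).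

Lemma mem_Occ_block x t : (ones x t <= k)%N ->
  block_start t \in Occ k (nseq_tuple m (symbol0 s)) (block_text x).
Proof.
move=> xt; apply: mem_Occ; first by case: t {xt} => [t tb] /=; nia.
apply: leq_trans xt; rewrite count_fragment.
apply: leq_trans (leq_imset_card (fun j => position (t, j)) _).
apply/subset_leq_card/subsetP => p; rewrite inE => /andP[/andP[/= tp pt] p1].
have jm : (p - 2 * m * t < m)%N by lia.
have pE : p = position (t, Ordinal jm) by apply/val_inj => /=; lia.
apply/imsetP; exists (Ordinal jm) => //; rewrite inE.
by apply: contraR p1 => p1; apply/block_text0; exists (t, Ordinal jm).
Qed.

Lemma notin_Occ_block x t : ones x t = k.+1 ->
  block_start t \notin Occ k (nseq_tuple m (symbol0 s)) (block_text x).
Proof.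
move=> xt; apply: notin_Occ.
have m0 : (0 < m)%N by lia.
have := @count_zeros_window x (block_start t) (t, Ordinal m0).
by rewrite /= xt; lia.
Qed.

(** A window that meets a block sees at most [m - k.+1] zeros, and any other window sees none; both
    numbers are below [m - k]. *)
Lemma Occ_eq0 x : (forall t, ones x t = k.+1) ->
  Occ k (nseq_tuple m (symbol0 s)) (block_text x) = set0.
Proof.
move=> xk; apply/setP => i; rewrite [RHS]inE; apply: negPf; apply: notin_Occ.
have [/existsP[c ic]|/existsPn H] := boolP [exists c, (i <= position c < i + m)%N].
  by apply: leq_ltn_trans (count_zeros_window x ic) _; rewrite xk; lia.
rewrite count_fragment (_ : [set p | _] = set0) ?cards0 ?subn_gt0 //.
apply/setP => p; rewrite !inE; apply/negP => /andP[ip /block_text0[c _ cp]].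
by have := H c; rewrite cp ip.
Qed.

Lemma ones_setD1 x c t : ones x t = (ones (x :\ c) t + ((c \in x) && (c.1 == t)))%N.
Proof.
case: c => [t' j'] /=; have [->|t't] := eqVneq t' t.
  rewrite andbT /ones (cardsD1 j' [set j | _]) inE addnC; congr (_ + _)%N.
  by apply: eq_card => j; rewrite !inE xpair_eqE eqxx.
rewrite andbF addn0; apply: eq_card => j.
by rewrite !inE xpair_eqE [t == t']eq_sym (negPf t't).
Qed.

Definition level (h : nat) : {set {set cell}} :=
  [set x | [forall t, (ones x t == k) || (ones x t == k.+1)] &&
           (#|[set t | ones x t == k]| == h)].

(** Removing [c] turns one block of [k.+1] ones into one of [k] and leaves the others alone. The
    equality lets edges be counted from either end. *)
Lemma level_setD1 h x c : c \in x -> ones x c.1 = k.+1 ->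
  (x \in level h) = (x :\ c \in level h.+1).
Proof.
move=> cx xc1; have xc t := ones_setD1 x c t; rewrite cx /= in xc.
have yc1 : ones (x :\ c) c.1 = k by have := xc c.1; rewrite eqxx; lia.
have xt t : c.1 != t -> ones x t = ones (x :\ c) t.
  by move=> ct; rewrite xc (negPf ct) addn0.
rewrite !inE; congr (_ && _).
  apply: eq_forallb => t; have [<-|ct] := eqVneq c.1 t; last by rewrite xt.
  by rewrite xc1 yc1 !eqxx orbT.
rewrite [in RHS](cardsD1 c.1) inE yc1 eqxx add1n eqSS; congr (_ == _).
apply: eq_card => t; rewrite !inE [t == _]eq_sym.
have [<-|ct] /= := eqVneq c.1 t; last by rewrite xt.
by rewrite xc1 eqn_leq ltnn.
Qed.

Lemma ones_level_setD1 h h' x c : c \in x -> x \in level h ->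
  x :\ c \in level h' -> ones x c.1 = k.+1.
Proof.
move=> cx; rewrite !inE => /andP[/forallP /(_ c.1) xk _].
move=> /andP[/forallP /(_ c.1) yk _].
have := ones_setD1 x c c.1; rewrite cx eqxx /=.
by case/orP: xk => /eqP ->; case/orP: yk => /eqP ->; lia.
Qed.

(** An edge is stored as its source and the cell that becomes a zero, which determine its target and
    its position. *)
Definition edges (h : nat) : {set {set cell} * cell} :=
  [set e | (e.1 \in level h) && ((e.2 \in e.1) && (e.1 :\ e.2 \in level h.+1))].

Lemma card_cells (P : {set 'I_b}) x (d : nat) :
  (forall t, t \in P -> ones x t = d) ->
  #|[set c | (c.1 \in P) && (c \in x)]| = (#|P| * d)%N.
Proof.
move=> Pd; rewrite -(card_fibres (Q := fun t j => (t, j) \in x)) //.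
by apply: eq_card => -[t j]; rewrite !inE.
Qed.

(** From a source, one of the [b - h] blocks with [k.+1] ones is chosen, then one of its ones. *)
Lemma card_edges_src h : #|edges h| = (#|level h| * ((b - h) * k.+1))%N.
Proof.
apply: (card_fibres (Q := fun x c => (c \in x) && (x :\ c \in level h.+1))).
move=> x xh; pose P := [set t | ones x t == k.+1].
have <- : #|P| = (b - h)%N.
  have := xh; rewrite inE => /andP[/forallP xk /eqP <-].
  rewrite cardsCs card_ord; congr (_ - _)%N; apply: eq_card => t; rewrite !inE.
  by have := xk t; have [->|] /= := eqVneq (ones x t) k; lia.
rewrite -(@card_cells P x) => [|t]; last by rewrite inE => /eqP.
apply: eq_card => c; rewrite in_set [in RHS]in_set [c.1 \in P]in_set andbC.
case: (boolP (c \in x)) => cx; rewrite ?andbF // !andbT.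
apply/idP/eqP => [yh|xc]; last by rewrite -level_setD1.
exact: ones_level_setD1 cx xh yh.
Qed.

(** From a target, one of the [h.+1] blocks with [k] ones is chosen, then one of its [m - k] zeros
    to turn back into a one. *)
Lemma card_edges_dst h : #|edges h| = (#|level h.+1| * (h.+1 * (m - k)))%N.
Proof.
pose swap (e : {set cell} * cell) := (e.1 :\ e.2, e.2).
have swap_inj : {in edges h &, injective swap}.
  move=> [x c] [x' c']; rewrite !inE /= => /and3P[_ cx _] /and3P[_ cx' _].
  move=> [xx' cc']; subst c'; congr (_, _).
  by rewrite -(setD1K cx) xx' setD1K.
rewrite -(card_in_imset swap_inj).
rewrite -(card_fibres (Q := fun y c => (c \notin y) && (c |: y \in level h))).
  apply: eq_card => -[y c]; rewrite !inE /=; apply/imsetP/and3P.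
    move=> [[x c']]; rewrite !inE /= => /and3P[xh c'x yh] [-> ->].
    by rewrite setD1K // !inE eqxx.
  move=> [yh cy xh]; exists (c |: y, c); last by rewrite /swap /= setU1K.
  by rewrite !inE /= eqxx setU1K // xh yh.
move=> y yh; pose P := [set t | ones y t == k].
have <- : #|P| = h.+1 by have := yh; rewrite inE => /andP[_ /eqP].
rewrite -(@card_cells P (~: y)) => [|t]; last first.
  by rewrite inE => /eqP <-; rewrite -card_zeros; apply: eq_card => j; rewrite !inE.
apply: eq_card => c.
rewrite in_set [in RHS]in_set [c.1 \in P]in_set in_setC andbC.
case: (boolP (c \in y)) => cy; rewrite ?andbF // !andbT.
have yE : (c |: y) :\ c = y by rewrite setU1K.
have cx : c \in c |: y by rewrite setU11.
have := ones_setD1 (c |: y) c c.1; rewrite cx eqxx yE addn1 => xE.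
apply/idP/eqP => [xh|yc]; last by rewrite (level_setD1 h cx) ?yE // xE yc.
apply: succn_inj; rewrite -xE; apply: (ones_level_setD1 cx xh).
by rewrite yE; exact: yh.
Qed.

Lemma level_gt0 h : (h <= b)%N -> (0 < #|level h|)%N.
Proof.
(* In the witness, block [t] begins with its [r t] ones; they fit because [k < m]. *)
move=> hb; pose r (t : 'I_b) := if (t < h)%N then k else k.+1.
pose x := [set c : cell | (c.2 < r c.1)%N].
have xr t : ones x t = r t.
  rewrite -[RHS](@card_ord_lt m) ?/r; last by case: ifP; lia.
  by apply: eq_card => j; rewrite !inE.
rewrite card_gt0; apply/set0Pn; exists x; rewrite inE; apply/andP; split.
  by apply/forallP => t; rewrite xr /r; case: ifP; rewrite eqxx ?orbT.
rewrite -[X in _ == X](card_ord_lt hb); apply/eqP/eq_card => t; rewrite !inE xr /r.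
by case: ifP => _; rewrite ?eqxx // eqn_leq ltnn.
Qed.

(** The answer is left abstract so that both the search and the decision problem are instances. *)
Lemma block_text_lower_bound (R : realType) (Out : eqType)
    (A : query_algorithm R n s Out) (answer : {set cell} -> Out) (h : nat) :
  (h < b)%N ->
  (forall x, 2 / 3 <= prob_of_output A (block_text x) (answer x)) ->
  (forall x c, x \in level h -> ones x c.1 = k.+1 -> ones (x :\ c) c.1 = k ->
    answer x != answer (x :\ c)) ->
  exists2 T : n.-tuple (symbol s), {subset T <= [:: symbol0 s; symbol1 s]} &
    36^-1 * Num.sqrt ((b - h) * k.+1 * (h.+1 * (m - k)))%:R <=
    (queries A T)%:R :> R.
Proof.
move=> hb correct differ.
have E0 : (0 < #|edges h|)%N.
  by rewrite card_edges_src muln_gt0 level_gt0 ?(ltnW hb) //= muln_gt0 subn_gt0 hb.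
have [||||||x _ xq] := @adversary_bound R n s Out _ _ block_text answer (level h)
  (level h.+1) (edges h) fst (fun e => e.1 :\ e.2) (position \o snd)
  _ _ _ _ _ _ A _ _ E0 (card_edges_src h) (card_edges_dst h) (fun x _ => correct x).
- by move=> e; rewrite inE => /andP[].
- by move=> e; rewrite inE => /and3P[].
- move=> [x c] [x' c'] _ _ /eqP; rewrite xpair_eqE.
  by case/andP => /= /eqP -> /eqP /position_inj ->.
- move=> [x c] [x' c']; rewrite !inE /= => /and3P[_ cx _] /and3P[_ cx' _].
  move/eqP; rewrite xpair_eqE => /andP[/eqP xx' /eqP /position_inj cc'].
  subst c'; congr (_, _).
  by rewrite -(setD1K cx) xx' setD1K.
- by move=> e _ p; apply: block_text_setD1.
- move=> e; rewrite inE => /and3P[xh cx yh].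
  have xc := ones_level_setD1 cx xh yh; apply: differ => //.
  by have := ones_setD1 e.1 e.2 e.2.1; rewrite cx eqxx xc addn1 => -[].
by exists (block_text x) => //; apply: block_text_binary.
Qed.

End Inputs.

(** * The number of blocks *)

Section Blocks.
Variables n m : nat.
Hypotheses (m0 : (0 < m)%N) (mn : (m <= n)%N).

Definition blocks := ((n + m) %/ (2 * m))%N.

Lemma blocks_fit : (2 * m * blocks <= n + m)%N.
Proof. by rewrite mulnC leq_trunc_div. Qed.

Lemma blocks_gt0 : (0 < blocks)%N.
Proof. by rewrite divn_gt0; lia. Qed.

(** Maximality of [blocks] gives [n < (2 * blocks + 1) * m], and [blocks] is positive. *)
Lemma blocks_ge (R : realType) : n%:R / m%:R <= 4 * blocks%:R :> R.
Proof.
have nm : (n <= 4 * blocks * m)%N.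
  have : (n + m < 2 * m * blocks.+1)%N by rewrite mulnC ltn_ceil //; lia.
  by have := blocks_gt0; nia.
by rewrite ler_pdivrMr ?ltr0n // -!natrM ler_nat.
Qed.

End Blocks.

(** * The two lower bounds *)

Lemma binary_subset (s : nat) (Sigma : {set symbol s}) (u : seq (symbol s)) :
  symbol0 s \in Sigma -> symbol1 s \in Sigma ->
  {subset u <= [:: symbol0 s; symbol1 s]} -> {subset u <= Sigma}.
Proof. by move=> S0 S1 uS a /uS; rewrite !inE => /orP[] /eqP ->. Qed.

Lemma nseq_binary (s m : nat) :
  {subset nseq_tuple m (symbol0 s) <= [:: symbol0 s; symbol1 s]}.
Proof. by move=> a /nseqP[-> _]; rewrite inE eqxx. Qed.

Lemma natr_sqrt (R : realType) (u v : nat) :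
  u%:R * Num.sqrt v%:R = Num.sqrt (u ^ 2 * v)%:R :> R.
Proof. by rewrite natrM sqrtrM ?ler0n // natrX sqrtr_sqr ger0_norm ?ler0n. Qed.

Theorem theorem4 (R : realType) :
  (exists2 c : R, 0 < c &
    forall (n m k s : nat) (Sigma : {set symbol s}),
      (0 < k)%N -> (k < m)%N -> (m <= n)%N ->
      symbol0 s \in Sigma -> symbol1 s \in Sigma ->
      forall A : m.-tuple (symbol s) -> query_algorithm R n s {set 'I_n.+1},
      solves_pattern_matching k Sigma A ->
      exists2 T : n.-tuple (symbol s),
        {subset T <= [:: symbol0 s; symbol1 s]} &
        c * (n%:R / m%:R * Num.sqrt (k * (m - k))%N%:R)
          <= (queries (A (nseq_tuple m (symbol0 s))) T)%:R)
  /\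
  (exists2 c : R, 0 < c &
    forall (n m k s : nat) (Sigma : {set symbol s}),
      (0 < k)%N -> (k < m)%N -> (m <= n)%N ->
      symbol0 s \in Sigma -> symbol1 s \in Sigma ->
      forall A : m.-tuple (symbol s) -> query_algorithm R n s bool,
      decides_pattern_matching k Sigma A ->
      exists2 T : n.-tuple (symbol s),
        {subset T <= [:: symbol0 s; symbol1 s]} &
        c * (Num.sqrt (n%:R / m%:R) * Num.sqrt (k * (m - k))%N%:R)
          <= (queries (A (nseq_tuple m (symbol0 s))) T)%:R).
Proof.
split.
(* 288 = 36 * 2 * 4: the adversary constant, then the root of [(b - h) * h.+1] being at least
   [b / 2] for [h = b./2], then [b] being at least [n / (4 * m)]. *)
- exists 288^-1 => [|n m k s Sigma k0 km mn S0 S1 A solves]; first by rewrite invr_gt0.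
  have m0 : (0 < m)%N by lia.
  have fit := blocks_fit n m; have b0 := blocks_gt0 m0 mn.
  have bn := blocks_ge m0 mn R; set b := blocks n m in fit b0 bn.
  have hb : (b./2 < b)%N by lia.
  pose text : {set 'I_b * 'I_m} -> n.-tuple (symbol s) := block_text s fit.
  have [x||T binT TQ] := block_text_lower_bound km
    (A := A (nseq_tuple m (symbol0 s))) (blocks_fit := fit)
    (answer := fun x => Occ k (nseq_tuple m (symbol0 s)) (text x)) hb.
  + by apply: solves; apply: binary_subset => //;
      [exact: nseq_binary | exact: block_text_binary].
  (* The start of the block of [c] is an occurrence only after the removal. *)
  + move=> x c _ xc yc; apply: contraTneq (mem_Occ_block s km fit (eq_leq yc)) => <-.
    exact: notin_Occ_block.
  exists T => //; apply: le_trans TQ.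
  apply: (@le_trans _ _ (288^-1 * (4 * b%:R * Num.sqrt (k * (m - k))%:R))).
    by rewrite ler_pM2l ?invr_gt0 // ler_wpM2r ?sqrtr_ge0.
  have -> : 288^-1 * (4 * b%:R * Num.sqrt (k * (m - k))%:R) =
    72^-1 * (b%:R * Num.sqrt (k * (m - k))%:R) :> R by field.
  have -> (z : R) : 36^-1 * z = 72^-1 * (2%:R * z) by field.
  rewrite ler_pM2l ?invr_gt0 // !natr_sqrt ler_wsqrtr // ler_nat.
  have -> : (2 ^ 2 * ((b - b./2) * k.+1 * (b./2.+1 * (m - k))) =
    (4 * ((b - b./2) * b./2.+1)) * (k.+1 * (m - k)))%N by lia.
  rewrite leq_mul ?leq_mul2r ?leqnSn ?orbT //.
  (* Both parities of [b] satisfy [b ^ 2 <= 4 * (b - b./2) * b./2.+1]. *)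
  by have : (b = b./2.*2 \/ b = b./2.*2.+1)%N by [lia|]; nia.
(* 72 = 36 * 2: here [h = 0], and the factor 4 of [blocks_ge] is under the root. *)
- exists 72^-1 => [|n m k s Sigma k0 km mn S0 S1 A decides]; first by rewrite invr_gt0.
  have m0 : (0 < m)%N by lia.
  have fit := blocks_fit n m; have b0 := blocks_gt0 m0 mn.
  have bn := blocks_ge m0 mn R; set b := blocks n m in fit b0 bn.
  pose text : {set 'I_b * 'I_m} -> n.-tuple (symbol s) := block_text s fit.
  have [x||T binT TQ] := block_text_lower_bound km
    (A := A (nseq_tuple m (symbol0 s))) (blocks_fit := fit)
    (answer := fun x => Occ k (nseq_tuple m (symbol0 s)) (text x) != set0) b0.
  + by apply: decides; apply: binary_subset => //;
      [exact: nseq_binary | exact: block_text_binary].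
  + move=> x c; rewrite inE => /andP[/forallP xk /eqP xh] _ yc.
    (* At level 0 no block has [k] ones, so the source has no occurrence at all. *)
    have xk1 t : ones x t = k.+1.
      case/orP: (xk t) => /eqP // xt.
      by have /setP/(_ t) := cards0_eq xh; rewrite !inE xt eqxx.
    rewrite /text (Occ_eq0 s km fit xk1) eqxx eq_sym.
    have -> // :
      Occ k (nseq_tuple m (symbol0 s)) (block_text s fit (x :\ c)) != set0.
    by apply/set0Pn; exists (block_start fit c.1); apply/mem_Occ_block/eq_leq.
  exists T => //; apply: le_trans TQ.
  have -> (z : R) : 36^-1 * z = 72^-1 * (2%:R * z) by field.
  rewrite ler_pM2l ?invr_gt0 // natr_sqrt -sqrtrM ?divr_ge0 ?ler0n //.
  rewrite ler_wsqrtr //; apply: (@le_trans _ _ (4 * b%:R * (k * (m - k))%:R)).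
    by rewrite ler_wpM2r ?ler0n.
  by rewrite -!natrM ler_nat; nia.
Qed.
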